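(* Let $n\ge 1$ be an integer, let $A=(a_{ij})$ be a real symmetric positive definite $n\times n$ matrix, and let $f_1,\dots,f_n:\mathbb{R}\to\mathbb{R}$ be continuous functions. Put $F_k(t):=\int_0^t f_k(s)\,ds$. Assume that: (1) for every $k\in\{1,\dots,n\}$, $\lim_{|s|\to\infty}\frac{f_k(s)}{s}=0$; (2) there exists $\nu_0>1$ such that $\lim_{s\to 0}\frac{f_k(s)}{|s|^{\nu_0}}=0$ for every $k\in\{1,\dots,n\}$; (3) $\sup_{t\in\mathbb{R}}\sum_{k=1}^n F_k(t)>0$. Then: (i) Set $$\lambda^{\star}:=\left(\frac{\mathrm{Tr}(A)+2\sum_{i<j}a_{ij}}{2}\right)\left(\max_{t\neq 0}\frac{\sum_{k=1}^{n}F_{k}(t)}{t^{2}}\right)^{-1},$$ which is a (well-defined) positive number. For every $\lambda>\lambda^{\star}$, the system $Au=\lambda f(u)$ has at least two distinct nontrivial (i.e. nonzero) solutions $u_\lambda^1,u_\lambda^2\in\mathbb{R}^n$, where $u_\lambda^1$ is a global minimum point of the functional $J_\lambda$. (ii) If, in addition, there exist $q\in(0,1)$ and $c>0$ such that $|f_k(s)|\le c|s|^q$ for every $s\in\mathbb{R}$ and every $k\in\{1,\dots,n\}$, then, as $\lambda\to\infty$, $$\|u_\lambda^1\|_2=o(\lambda^{1/(1-r)})\quad\text{for every } r\in(q,1),$$ but $$\|u_\lambda^1\|_2\neq O(\lambda^{1/(1-\mu)})\quad\text{for every }\mu>1.$$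
   Context: For $u=(u_1,\dots,u_n)^t\in\mathbb{R}^n$, $f(u):=(f_1(u_1),\dots,f_n(u_n))^t$ and $\|u\|_2:=(\sum_{k=1}^n u_k^2)^{1/2}$. The energy functional associated with the system $Au=\lambda f(u)$ is $J_\lambda:\mathbb{R}^n\to\mathbb{R}$, $J_\lambda(u):=\tfrac12 u^tAu-\lambda\sum_{k=1}^n F_k(u_k)$. $\mathrm{Tr}(A)$ denotes the trace of $A$. *)

(* Defs.v *)
From HB Require Import structures.
From mathcomp Require Import all_boot all_order all_algebra.
From mathcomp Require Import all_classical all_reals all_analysis.

Set Implicit Arguments.
Unset Strict Implicit.
Unset Printing Implicit Defensive.

Import Order.TTheory GRing.Theory Num.Theory.
Import numFieldNormedType.Exports.

Local Open Scope classical_set_scope.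
Local Open Scope ring_scope.

(* Lets the Landau notations [f =o_+oo g] and [f =O_+oo g] find the filter of
   neighborhoods of +oo. *)
Canonical pinfty_filter_on (R : numFieldType) : filter_on R :=
  FilterType (pinfty_nbhs R) (@proper_pinfty_nbhs R).

Section Definitions.
Context {R : realType}.
Implicit Types (n : nat) (t lambda : R) (g : R -> R) (S : set R).

(* The oriented integral of g from 0 to t: the library integrates over sets
   only, so the sign for t < 0 is put by hand. *)
Definition primitive g t : R :=
  if 0 <= t then \int[lebesgue_measure]_(s in `[0, t]) g s
  else - \int[lebesgue_measure]_(s in `[t, 0]) g s.

Definition posdef_mx n (A : 'M[R]_n) : Prop :=
  forall u : 'cV[R]_n, u != 0 -> 0 < (u^T *m A *m u) 0 0.

Definition norm2 n (u : 'cV[R]_n) : R :=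
  Num.sqrt (\sum_(k < n) u k 0 ^+ 2).

Definition is_maximum S (m : R) : Prop := S m /\ ubound S m.

(* Meaningful only when S has a maximum. *)
Definition maximum S : R := get (is_maximum S).

Section System.
Context {n : nat} (A : 'M[R]_n) (f : 'I_n -> R -> R).
Implicit Types u : 'cV[R]_n.

Definition nonlinearity u : 'cV[R]_n := \col_k f k (u k 0).

Definition is_solution lambda u : Prop :=
  A *m u = lambda *: nonlinearity u.

Definition energy lambda u : R :=
  2^-1 * (u^T *m A *m u) 0 0 - lambda * \sum_(k < n) primitive (f k) (u k 0).

Definition is_global_min (J : 'cV[R]_n -> R) u : Prop :=
  forall v, J u <= J v.

Definition sum_primitive t : R := \sum_(k < n) primitive (f k) t.

Definition quotients : set R :=
  [set sum_primitive t / t ^+ 2 | t in [set t | t != 0]].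

Definition lambda_star : R :=
  (\tr A + 2 * \sum_(i < n) \sum_(j < n | (i < j)%N) A i j) / 2
  * (maximum quotients)^-1.

End System.
End Definitions.

(* Main.v *)
Require Import Defs.
From mathcomp Require Import all_boot all_order all_algebra.
From mathcomp Require Import all_classical all_reals all_analysis.
From mathcomp Require Import ring lra.

(** Critical points of the energy [J] are the solutions, and [J] is coercive
    because the primitives grow subquadratically.  For [lambda > lambda_star],
    [J] is negative at some [t * (1, ..., 1)], so its global minimizer [u1] is
    nonzero; since [J] is positive on small spheres around [0], a mountain pass
    between [0] and [u1] gives the second solution, at a positive level.

    The mountain pass theorem is proved without a flow: the mountain pass level
    is the infimum of the levels [a] such that [{J <= a}] contains a connected
    set joining the two points.  A single gradient step [u - e * grad J(u)] is
    continuous, fixes the two endpoints (they are critical), and, by compactness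
    of the sublevel sets, lowers such a set strictly below a level that carries
    no critical point.

    For the asymptotics, testing the system against [u1] gives
    [|u1| <= C * lambda ^ (1 / (1 - q))], while
    [- lambda * sum_k F_k(u1_k) <= J(u1) <= J(t0, ..., t0)] prevents [u1] from
    tending to [0]. *)

Set Implicit Arguments.
Unset Strict Implicit.
Unset Printing Implicit Defensive.

Import Order.TTheory GRing.Theory Num.Theory.
Import numFieldNormedType.Exports.

Local Open Scope classical_set_scope.
Local Open Scope ring_scope.

(** * Primitives of continuous functions: differentiability and growth *)

Section calculus.
Context {R : realType}.
Implicit Types (f F : R -> R) (s t x e : R).

Lemma primitive0 f : primitive f 0 = 0.
Proof. by rewrite /primitive lexx set_itv1 Rintegral_set1. Qed.

(** Near [t] the sign split in [primitive] disappears in the difference [G x - G 0], where [G]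
    integrates from a fixed point [- M] to the left of both [0] and [t]. The fundamental theorem
    then applies inside [[- M, M]]. *)
Lemma is_derive_primitive f : continuous f ->
  forall t, is_derive t 1 (primitive f) (f t).
Proof.
move=> cf t; set M := `|t| + 1.
have M_gt0 : 0 < M by rewrite ltr_wpDl.
have ltM : - M < t < M by rewrite -ltr_norml ltrDl.
have fi a b : lebesgue_measure.-integrable `[a, b] (EFin \o f).
  apply: continuous_compact_integrable; first exact: segment_compact.
  exact: continuous_subspaceT.
pose G x := \int[lebesgue_measure]_(s in `[- M, x]) f s.
have GE : {near t, (fun x => G x - G 0) =1 primitive f}.
  near=> x.
  have /andP[Mx xM] : - M < x < M.
    by near: x; apply: near_in_itvoo; rewrite in_itv.
  rewrite /primitive; case: ifPn => [x0|].
    rewrite /G Rintegral_itvB// ?bnd_simp ?oppr_le0 ?(ltW M_gt0)//.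
    rewrite Rintegral_itv_obnd_cbnd//.
    by apply: integrableS (fi 0 x) => //; exact: subset_itv_oc_cc.
  rewrite -ltNge => x0; rewrite -opprB; congr -%R.
  rewrite /G Rintegral_itvB// ?bnd_simp ?(ltW Mx) ?(ltW x0)//.
  rewrite Rintegral_itv_obnd_cbnd//.
  by apply: integrableS (fi x 0) => //; exact: subset_itv_oc_cc.
have [Mt tM] := andP ltM.
have [dG Gf] := continuous_FTC1_closed tM (fi _ _) Mt (cf t).
apply: (near_eq_is_derive GE); rewrite -Gf -[X in is_derive _ _ _ X]subr0.
apply: is_deriveB; apply: DeriveDef => //; first by rewrite derive1E.
Unshelve. all: by end_near. Qed.

Section primitive_bounds.
Variables (f F : R -> R).
Hypotheses (F0 : F 0 = 0) (dF : forall t, is_derive t 1 F (f t)).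

Lemma is_derive_continuous : continuous F.
Proof.
by move=> t; apply: differentiable_continuous; apply/derivable1_diffP.
Qed.

Lemma mean_value_from0 t : exists2 s, `|s| <= `|t| & F t = f s * t.
Proof.
have cF a b : {within `[a, b], continuous F}.
  exact/continuous_subspaceT/is_derive_continuous.
have [t0|t0] := leP 0 t.
  have [s] := MVT_segment t0 (fun x _ => dF x) (cF 0 t).
  rewrite in_itv/= F0 !subr0 => /andP[s0 st] ->; exists s => //.
  by rewrite !ger0_norm.
have [s] := MVT_segment (ltW t0) (fun x _ => dF x) (cF t 0).
rewrite in_itv/= F0 !sub0r mulrN => /andP[ts s0] /oppr_inj ->; exists s => //.
by rewrite !ler0_norm// ?lerN2// ltW.
Qed.

Lemma primitive_le_near0 e : (\forall s \near 0, `|f s| <= e * `|s|) ->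
  \forall t \near 0, `|F t| <= e * t ^+ 2.
Proof.
move=> /nbhs_ballP[d /= d0 fd]; apply/nbhs_ballP; exists d => //= t.
rewrite /ball/= sub0r normrN => td; have [s st ->] := mean_value_from0 t.
rewrite normrM -real_normK ?num_real// expr2 mulrA ler_wpM2r//.
have fs : `|f s| <= e * `|s|.
  by apply: fd; rewrite /ball/= sub0r normrN (le_lt_trans st).
(* The bound at [s] reveals [0 <= e] only if [s != 0]; otherwise the sign of [e] is read off at the
   nonzero point [d / 2]. *)
have [s0|s0] := eqVneq s 0.
  move: fs; rewrite s0 normr0 mulr0 => fs; apply: (le_trans fs).
  have : `|f (d / 2)| <= e * `|d / 2|.
    apply: fd; rewrite /ball/= sub0r normrN ger0_norm ?ltr_pdivrMr//; last first.
      by rewrite ltW// divr_gt0.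
    by rewrite ltr_pMr// ltr1n.
  have d20 : 0 < `|d / 2| by rewrite normr_gt0 gt_eqF// divr_gt0.
  move=> /(le_trans (normr_ge0 _)); rewrite pmulr_lge0// => e0.
  by rewrite mulr_ge0.
have e0 : 0 <= e.
  have s0' : 0 < `|s| by rewrite normr_gt0.
  by move: (le_trans (normr_ge0 _) fs); rewrite pmulr_lge0.
by apply: (le_trans fs); rewrite ler_wpM2l.
Qed.

(** Outside [[- M, M]] the limits give [|f s| <= e / 2 * |s|]; inside, continuity gives
    [|f s| <= B]. The other half of [e] absorbs the linear term [B * |t|]. *)
Lemma primitive_le_quadratic e : continuous f -> 0 < e ->
  f s / s @[s --> +oo] --> 0 -> f s / s @[s --> -oo] --> 0 ->
  exists2 C, 0 <= C & forall t, `|F t| <= e * t ^+ 2 + C.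
Proof.
move=> cf e0 fy fNy; have e20 : 0 < e / 2 by rewrite divr_gt0.
move/cvgr0Pnorm_le : fy => /(_ _ e20)[My [_ fMy]].
move/cvgr0Pnorm_le : fNy => /(_ _ e20)[MN [_ fMN]].
pose M := 1 + `|My| + `|MN|.
have M0 : 0 < M by rewrite !ltr_wpDr.
have f_far s : M < `|s| -> `|f s| <= e / 2 * `|s|.
  move=> Ms; have sn0 : 0 < `|s| by apply: lt_trans Ms.
  have : `|f s / s| <= e / 2.
    have [s0|s0] := leP 0 s.
      apply: fMy; apply: le_lt_trans (ler_norm _) _; move: Ms.
      rewrite ger0_norm//; apply: le_lt_trans.
      by rewrite /M addrAC lerDr addr_ge0.
    apply: fMN; rewrite -ltrN2; move: Ms; rewrite ltr0_norm//.
    apply: le_lt_trans; apply: (le_trans (ler_norm _)).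
    by rewrite normrN /M lerDr addr_ge0.
  by rewrite normrM normfV ler_pdivrMr.
have MM : - M <= M by rewrite ge0_cp ?ltW.
have [c _ fc] := EVT_max MM
  (continuous_subspaceT (fun s => cvg_norm (cf s))).
set B := `|f c|; exists (B ^+ 2 / (2 * e)).
  by rewrite divr_ge0 ?sqr_ge0// mulr_ge0// ltW.
move=> t; have [s st ->] := mean_value_from0 t.
rewrite normrM -(real_normK (num_real t)).
have fs : `|f s| <= e / 2 * `|s| + B.
  have [Ms|sM] := ltP M `|s|.
    by apply: (le_trans (f_far _ Ms)); rewrite lerDl normr_ge0.
  apply: (@le_trans _ _ B); first by apply: fc; rewrite in_itv/= -ler_norml.
  by rewrite lerDr mulr_ge0// ltW.
have {}fs : `|f s| <= e / 2 * `|t| + B.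
  by apply: (le_trans fs); rewrite lerD2r ler_wpM2l// ltW.
apply: (le_trans (ler_wpM2r (normr_ge0 t) fs)).
(* AM-GM *)
suff : B * `|t| <= e / 2 * `|t| ^+ 2 + B ^+ 2 / (2 * e) by lra.
rewrite -subr_ge0.
have -> : e / 2 * `|t| ^+ 2 + B ^+ 2 / (2 * e) - B * `|t| =
    (e * `|t| - B) ^+ 2 / (2 * e) by field; rewrite gt_eqF.
by rewrite divr_ge0 ?sqr_ge0// mulr_ge0// ltW.
Qed.
End primitive_bounds.
End calculus.

(** * Mountain pass by descent steps, with compact sublevel sets *)

Section mountain_pass.
Context {R : realType} {V : normedModType R}.
Variables (J : V -> R) (g : V -> V).
Hypotheses (J_cont : continuous J) (g_cont : continuous g).
Hypothesis J_sublevel_compact : forall a, compact [set u | J u <= a].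
(** The product filter makes the admissible step sizes uniform around [u], as the covering argument
    for the deformation requires. *)
Hypothesis J_descent : forall u, g u != 0 ->
  \forall v \near u & e \near 0^'+, J (v - e *: g v) < J v.

Let step_continuous : continuous (fun ev : R * V => J (ev.2 - ev.1 *: g ev.2)).
Proof.
move=> ev; apply: continuous_comp; last exact: J_cont.
apply: cvgB; first exact: cvg_snd.
apply: cvgZ; first exact: cvg_fst.
by apply: continuous_comp; [exact: cvg_snd|exact: g_cont].
Qed.

Lemma minimizer_critical u : (forall v, J u <= J v) -> g u = 0.
Proof.
move=> umin; apply/eqP/contraT => /J_descent[[A B] [/= Au B0] AB].
have [e Be] := filter_ex B0.
have /= := AB (u, e) (conj (nbhs_singleton Au) Be).
by rewrite ltNge umin.
Qed.

(** Two successive covering arguments: the first fixes a step [e] sending [{J <= c}] strictly below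
    [c]; the second, with [e] fixed, finds the margin [d]. *)
Lemma sublevel_deformation c : (forall u, g u = 0 -> J u != c) ->
  exists e d : R, 0 < d /\
    forall u, J u <= c + d -> J (u - e *: g u) <= c - d.
Proof.
move=> noncrit.
have [e Je] : exists e, forall u, J u <= c -> J (u - e *: g u) < c.
  have /compact_near_coveringP/(_ _ 0^'+
    (fun e v => J v <= c -> J (v - e *: g v) < c)) : compact [set u | J u <= c].
    exact: J_sublevel_compact.
  move=> /(_ _ _)/filter_ex[|e He]; last first.
    by exists e => u Ju; apply: He.
  (* On the level [c] itself [u] is not critical and descent applies. Strictly below [c], it is
     enough that the step is continuous and trivial at [e = 0]. *)
  move=> u /=; rewrite le_eqVlt => /predU1P[Juc|Juc].
    have : g u != 0 by apply: contra_eq_neq Juc => /noncrit.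
    by move/J_descent; apply: filterS => -[v e] /= + Jv => /lt_le_trans; apply.
  have : \forall ev \near (0 : R, u), J (ev.2 - ev.1 *: g ev.2) < c.
    by apply: cvgr_lt (@step_continuous _) _ _; rewrite /= scale0r subr0.
  move=> -[[/= A B] [A0 Bu] AB]; exists (B, A) => /=.
    by split => //; exact: cvg_at_right_filter A0.
  by move=> [v e] /= [Bv Ae] _; apply: (AB (e, v)).
exists e.
(* The sublevel set at [c + 1] is a compact set containing [{J <= c + d}] for every [d <= 1]. Near a
   point with [J u <= c] the step lands below [c - m]; near a point with [J u > c] the premise fails
   for all [d <= m]. *)
have : \forall d \near 0^'+, [set u | J u <= c + 1] `<=`
    (fun v => J v <= c + d -> J (v - e *: g v) <= c - d).
  have /compact_near_coveringP : compact [set u | J u <= c + 1].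
    exact: J_sublevel_compact.
  apply => u _ /=.
  have [Juc|Juc] := leP (J u) c.
    have Jeu := Je _ Juc; pose m := (c - J (u - e *: g u)) / 2.
    have m0 : 0 < m by rewrite divr_gt0// subr_gt0.
    have : \forall v \near u, J (v - e *: g v) < c - m.
      have cs : {for u, continuous (fun v => J (v - e *: g v))}.
        apply: continuous_comp; last exact: J_cont.
        apply: cvgB; first exact: cvg_id.
        by apply: cvgZ; [exact: cvg_cst|exact: g_cont].
      apply: cvgr_lt cs _ _.
      rewrite /m; lra.
    move=> Hv; exists ([set v | J (v - e *: g v) < c - m], [set d | d <= m]).
      by split => //; exact: nbhs_right_ltW.
    move=> [v d] /= [Hv' dm] _.
    by rewrite (le_trans (ltW Hv'))// lerD2l lerN2.
  pose m := (J u - c) / 2.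
  have m0 : 0 < m by rewrite divr_gt0// subr_gt0.
  exists ([set v | c + m < J v], [set d | d <= m]) => /=.
    split; last exact: nbhs_right_ltW.
    by apply: cvgr_gt (@J_cont u) _ _; rewrite /m; lra.
  move=> [v d] /= [Jv dm] Jvd; move: (lt_le_trans Jv Jvd).
  by rewrite ltrD2l ltNge dm.
move=> H.
have [d [Hd [d0 d1]]] : exists d : R, ([set u | J u <= c + 1] `<=`
    (fun v => J v <= c + d -> J (v - e *: g v) <= c - d)) /\ 0 < d /\ d <= 1.
  near (0 : R)^'+ => d; exists d; split; first exact: (near H d).
  split; near: d; first exact: nbhs_right_gt.
  exact: nbhs_right_ltW.
exists d; split => // u Ju; apply: Hd => //=.
by rewrite (le_trans Ju)// lerD2l.
Unshelve. all: by end_near. Qed.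

(** Connected sets stand in for paths, since their images under the continuous step are again
    connected. The critical point lies at level [inf levels], which the barrier keeps at or above
    [alpha]. *)
Lemma mountain_pass_critical_point x0 x1 alpha :
    g x0 = 0 -> g x1 = 0 ->
    (forall K, connected K -> K x0 -> K x1 -> exists2 u, K u & alpha <= J u) ->
  exists2 u, g u = 0 & alpha <= J u.
Proof.
move=> g0 g1 barrier.
pose levels := [set a | exists K, [/\ connected K, K x0, K x1 &
                                   forall u, K u -> J u <= a]].
have levels_lb : lbound levels alpha.
  move=> a [K [Kc K0 K1 Ka]]; have [u Ku] := barrier _ Kc K0 K1.
  by move/le_trans; apply; exact: Ka.
have levels_n0 : levels !=set0.
  (* The segment from [x0] to [x1] provides one level. *)
  pose p (t : R) : V := x0 + t *: (x1 - x0).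
  have cp : continuous p.
    move=> t; apply: cvgD; first exact: cvg_cst.
    by apply: cvgZ; [exact: cvg_id|exact: cvg_cst].
  have cJp : {within `[0, 1], continuous (J \o p)}.
    apply: continuous_subspaceT => t.
    by apply: continuous_comp; [exact: cp|exact: J_cont].
  have [c _ cmax] := EVT_max (@ler01 R) cJp.
  exists (J (p c)); exists (p @` `[0, 1]); split.
  - apply: connected_continuous_connected; first exact: segment_connected.
    exact: continuous_subspaceT.
  - by exists 0; rewrite /= ?in_itv/= ?lexx ?ler01// /p scale0r addr0.
  - by exists 1; rewrite /= ?in_itv/= ?lexx ?ler01// /p scale1r subrKC.
  - by move=> _ [t t01 <-]; exact: cmax.
have levels_inf : has_inf levels by split => //; exists alpha.
have alphac : alpha <= inf levels by exact: lb_le_inf.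
apply: contrapT => nocrit.
(* Without a critical point at this level, a connected set of level below [inf levels + d] would be
   moved to one of level [inf levels - d], still joining [x0] and [x1] because [g] vanishes
   there. *)
have [u gu|e [d [d0 Hd]]] := @sublevel_deformation (inf levels).
  by apply/eqP => Ju; apply: nocrit; exists u; rewrite ?Ju.
have [a [K [Kc K0 K1 Ka]] ad] := inf_adherent d0 levels_inf.
suff : inf levels <= inf levels - d by rewrite lerDl oppr_ge0 leNgt d0.
apply: ge_inf; first by exists alpha.
exists ((fun u => u - e *: g u) @` K); split.
- apply: connected_continuous_connected => //.
  apply: continuous_subspaceT => u; apply: cvgB; first exact: cvg_id.
  by apply: cvgZ; [exact: cvg_cst|exact: g_cont].
- by exists x0; rewrite // g0 scaler0 subr0.
- by exists x1; rewrite // g1 scaler0 subr0.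
- by move=> _ [u Ku <-]; apply: Hd; exact: le_trans (Ka _ Ku) (ltW ad).
Qed.

End mountain_pass.

(** * Column vectors: squared Euclidean norm, compactness, bilinear forms *)

Section column_vectors.
Context {R : realType} {n : nat}.
Implicit Types (u v w : 'cV[R]_n) (A : 'M[R]_n).

Lemma continuous_sum (T : topologicalType) (I : Type) (s : seq I)
    (F : I -> T -> R) :
  (forall i, continuous (F i)) -> continuous (fun x => \sum_(i <- s) F i x).
Proof.
move=> cF x; elim: s => [|i s IH].
  by under eq_fun do rewrite big_nil; exact: cvg_cst.
under eq_fun do rewrite big_cons.
by apply: cvgD; [exact: cF|exact: IH].
Qed.

Lemma continuous_mul (T : topologicalType) (F G : T -> R) :
  continuous F -> continuous G -> continuous (fun x => F x * G x).
Proof. by move=> cF cG x; apply: cvgM; [exact: cF|exact: cG]. Qed.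

Lemma continuous_sub (T : topologicalType) (F G : T -> R) :
  continuous F -> continuous G -> continuous (fun x => F x - G x).
Proof. by move=> cF cG x; apply: cvgB; [exact: cF|exact: cG]. Qed.

Lemma continuous_cV (T : topologicalType) (h : T -> 'cV[R]_n) :
  (forall i, continuous (fun x => h x i 0)) -> continuous h.
Proof.
move=> ch x; apply/cvg_ballP => e e0.
suff : \forall y \near x, forall i, ball (h x i 0) e (h y i 0).
  by apply: filterS => y hy; split => // i j; rewrite ord1; exact: hy.
by apply: filter_forall => i; move/cvg_ballP : (ch i x); apply.
Qed.

(** The square of [norm2], without the root so that it is polynomial in the coordinates. *)
Definition sqnorm u : R := \sum_(k < n) u k 0 ^+ 2.

Lemma sqnorm_ge0 u : 0 <= sqnorm u.
Proof. by apply: sumr_ge0 => k _; exact: sqr_ge0. Qed.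

Lemma sqnorm_eq0 u : (sqnorm u == 0) = (u == 0).
Proof.
apply/eqP/eqP => [u0|->]; last by apply: big1 => k _; rewrite mxE expr0n.
apply/colP => k; rewrite mxE; apply/eqP; rewrite -sqrf_eq0; apply/eqP.
by apply: (psumr_eq0P _ u0) => // i _; exact: sqr_ge0.
Qed.

Lemma sqnorm0 : sqnorm 0 = 0. Proof. by apply/eqP; rewrite sqnorm_eq0. Qed.

Lemma sqnorm_gt0 u : (0 < sqnorm u) = (u != 0).
Proof. by rewrite lt0r sqnorm_ge0 andbT sqnorm_eq0. Qed.

Lemma sqnormZ (a : R) u : sqnorm (a *: u) = a ^+ 2 * sqnorm u.
Proof. by rewrite mulr_sumr; apply: eq_bigr => k _; rewrite mxE exprMn. Qed.

Lemma sqnorm_const (t : R) : sqnorm (const_mx t) = n%:R * t ^+ 2.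
Proof.
rewrite /sqnorm; under eq_bigr do rewrite mxE.
by rewrite sumr_const card_ord mulr_natl.
Qed.

Lemma coord_le_sqnorm u k : u k 0 ^+ 2 <= sqnorm u.
Proof.
by rewrite /sqnorm (bigD1 k)//= lerDl sumr_ge0// => i _; exact: sqr_ge0.
Qed.

Lemma continuous_coord (k : 'I_n) : continuous (fun u : 'cV[R]_n => u k 0).
Proof. exact: coord_continuous. Qed.

Lemma sqnorm_continuous : continuous sqnorm.
Proof.
apply: continuous_sum => k; under eq_fun do rewrite expr2.
by apply: continuous_mul; exact: continuous_coord.
Qed.

(** The box is the image under transposition of a product of segments in the row vectors. *)
Lemma cV_box_compact (M : R) :
  compact [set u : 'cV[R]_n | forall k, `|u k 0| <= M].
Proof.
have -> : [set u : 'cV[R]_n | forall k, `|u k 0| <= M] =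
    trmx @` [set v : 'rV[R]_n | forall k, v ord0 k \in `[- M, M]].
  apply/seteqP; split => [u uM|_ [v vM <-] k]; last first.
    by have := vM k; rewrite in_itv/= mxE ler_norml.
  exists u^T; last by rewrite trmxK.
  by move=> k; rewrite mxE in_itv/= -ler_norml.
apply: continuous_compact.
  apply: continuous_subspaceT; apply: continuous_cV => k.
  by under eq_fun do rewrite mxE; exact: coord_continuous.
apply: (@rV_compact _ _ (fun=> `[- M, M]%classic)).
by move=> _; apply: segment_compact.
Qed.

Lemma sqnorm_bounded_compact (S : set 'cV[R]_n) (b : R) :
  closed S -> (forall u, S u -> sqnorm u <= b) -> compact S.
Proof.
move=> Sc Sb; apply: subclosed_compact Sc (@cV_box_compact (Num.sqrt b)) _.
move=> u Su k; rewrite -sqrtr_sqr ler_sqrt ?(le_trans (sqnorm_ge0 u))//.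
  exact: le_trans (coord_le_sqnorm u k) (Sb _ Su).
exact: Sb.
Qed.

Definition bform A u v : R := (u^T *m A *m v) 0 0.

Lemma bform0l A v : bform A 0 v = 0.
Proof. by rewrite /bform trmx0 !mul0mx mxE. Qed.

Lemma bformE A u v : bform A u v = \sum_(k < n) u k 0 * (A *m v) k 0.
Proof. by rewrite /bform -mulmxA mxE; apply: eq_bigr => k _; rewrite mxE. Qed.

Lemma bformBr A u v w : bform A u (v - w) = bform A u v - bform A u w.
Proof. by rewrite /bform mulmxBr !mxE. Qed.

Lemma bformZr A (a : R) u v : bform A u (a *: v) = a * bform A u v.
Proof. by rewrite /bform -scalemxAr mxE. Qed.

Lemma bformC A u v : A^T = A -> bform A u v = bform A v u.
Proof.
move=> As; rewrite /bform.
by rewrite -[in LHS](trmxK (u^T *m A *m v)) mxE !trmx_mul trmxK As mulmxA.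
Qed.

Lemma bform_sub A u v (s : R) : A^T = A ->
  bform A (u - s *: v) (u - s *: v) =
  bform A u u - 2 * s * bform A v u + s ^+ 2 * bform A v v.
Proof.
move=> As; rewrite bformBr bformZr (bformC (u - _) u As) (bformC (u - _) v As).
rewrite !bformBr !bformZr (bformC u v As) expr2; ring.
Qed.

Lemma mulmx_continuous A (k : 'I_n) : continuous (fun u => (A *m u) k 0).
Proof.
under eq_fun do rewrite mxE.
apply: continuous_sum => i.
by apply: continuous_mul; [exact: cst_continuous|exact: continuous_coord].
Qed.

Lemma bform_diag_continuous A : continuous (fun u => bform A u u).
Proof.
under eq_fun do rewrite bformE.
apply: continuous_sum => i.
by apply: continuous_mul; [exact: continuous_coord|exact: mulmx_continuous].
Qed.

(** The constant is the minimum of the form on the unit sphere, attained by compactness; homogeneity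
    extends the bound to all vectors. *)
Lemma posdef_coercive A : posdef_mx A ->
  exists2 m, 0 < m & forall u, m * sqnorm u <= bform A u u.
Proof.
move=> Apos; pose S := [set u | sqnorm u = 1].
have normalized u : u != 0 -> S ((Num.sqrt (sqnorm u))^-1 *: u).
  rewrite -sqnorm_gt0 => u0.
  by rewrite /S/= sqnormZ exprVn sqr_sqrtr ?ltW// mulVf// gt_eqF.
(* An empty sphere means that [0] is the only vector ([n = 0]), and any constant works. *)
have [S0|/set0P Sn0] := eqVneq S set0.
  exists 1 => // u; have [->|/normalized] := eqVneq u 0; last by rewrite S0.
  by rewrite sqnorm0 bform0l mulr0.
have Sc : compact S.
  apply: (@sqnorm_bounded_compact _ 1); last by move=> u ->.
  apply: (@preimage_closed _ _ sqnorm [set 1]) => [u _|].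
    exact: sqnorm_continuous.
  exact: closed_eq.
have [c] := compact_EVT_min Sn0 Sc
  (continuous_subspaceT (@bform_diag_continuous A)).
rewrite inE => Scc cmin; exists (bform A c c).
  by apply: Apos; rewrite -sqnorm_gt0 Scc.
move=> u; have [->|u0] := eqVneq u 0.
  by rewrite sqnorm0 bform0l mulr0.
have := cmin _ (mem_set (normalized _ u0)).
rewrite bformZr
  (_ : bform A (_ *: _) u = (Num.sqrt (sqnorm u))^-1 * bform A u u).
  rewrite mulrA -expr2 exprVn sqr_sqrtr ?sqnorm_ge0// ler_pdivlMl ?sqnorm_gt0//.
  by rewrite mulrC.
by rewrite /bform linearZ/= -!scalemxAl mxE.
Qed.

End column_vectors.

(** * The energy, its gradient and its descent along the gradient *)

Section energy.
Context {R : realType} {n : nat}.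
Variables (A : 'M[R]_n) (f : 'I_n -> R -> R).
Hypothesis A_sym : A^T = A.
Hypothesis f_cont : forall k, continuous (f k).
Implicit Types (u v w : 'cV[R]_n) (lambda e : R).

Definition potential u : R := \sum_(k < n) primitive (f k) (u k 0).

(** The gradient of the energy for symmetric [A]; [is_derive_energy] checks this along lines. *)
Definition residual lambda u : 'cV[R]_n := A *m u - lambda *: nonlinearity f u.

Lemma energyE lambda u :
  energy A f lambda u = 2^-1 * bform A u u - lambda * potential u.
Proof. by []. Qed.

Lemma is_solutionE lambda u :
  is_solution A f lambda u <-> residual lambda u = 0.
Proof. by rewrite /residual; split=> [->|/subr0_eq]//; rewrite subrr. Qed.

Lemma residualE lambda u k :
  residual lambda u k 0 = (A *m u) k 0 - lambda * f k (u k 0).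
Proof. by rewrite /residual /nonlinearity !mxE. Qed.

Lemma continuous_residual_coord lambda k :
  continuous (fun u => residual lambda u k 0).
Proof.
under eq_fun do rewrite residualE.
apply: continuous_sub; first exact: mulmx_continuous.
apply: continuous_mul; first exact: cst_continuous.
by move=> u; apply: continuous_comp; [exact: continuous_coord|exact: f_cont].
Qed.

Lemma continuous_residual lambda : continuous (residual lambda).
Proof. by apply: continuous_cV => k; exact: continuous_residual_coord. Qed.

Lemma continuous_potential : continuous potential.
Proof.
apply: continuous_sum => k u.
apply: continuous_comp; first exact: continuous_coord.
exact: is_derive_continuous (is_derive_primitive (@f_cont k)) _.
Qed.

Lemma continuous_energy lambda : continuous (energy A f lambda).
Proof.
apply: continuous_sub; (apply: continuous_mul; first exact: cst_continuous).
  exact: bform_diag_continuous.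
exact: continuous_potential.
Qed.

Lemma is_derive_energy lambda v w (s : R) :
  is_derive s 1 (fun t : R => energy A f lambda (v - t *: w))
    (- \sum_(k < n) residual lambda (v - s *: w) k 0 * w k 0).
Proof.
have -> : (fun t : R => energy A f lambda (v - t *: w)) =
    (fun t : R => 2^-1 * (bform A v v - 2 * t * bform A w v +
                          t ^+ 2 * bform A w w)) -
    lambda *: (\sum_(k < n) (fun t : R => primitive (f k) (v k 0 - t * w k 0))).
  apply/funext => t; rewrite energyE bform_sub//= !fctE; congr (_ - _ * _).
  rewrite fct_sumE; apply: eq_bigr => k _; congr primitive; by rewrite !mxE.
have dq : is_derive s 1 (fun t : R => 2^-1 * (bform A v v -
    2 * t * bform A w v + t ^+ 2 * bform A w w)) (s * bform A w w - bform A w v).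
  by apply: is_derive_eq; rewrite /GRing.scale/=; field.
have dP : is_derive s 1
    (\sum_(k < n) (fun t : R => primitive (f k) (v k 0 - t * w k 0)))
    (\sum_(k < n) f k (v k 0 - s * w k 0) * - w k 0).
  apply: is_derive_sum => k.
  apply: (@is_derive1_comp _ (primitive (f k)) (fun t => v k 0 - t * w k 0)).
    exact: is_derive_primitive.
  by apply: is_derive_eq; rewrite /GRing.scale/=; ring.
apply: is_derive_eq (is_deriveB dq (is_deriveZ lambda dP)) _.
under [in RHS]eq_bigr do rewrite residualE mulrBl.
rewrite sumrB opprB.
have -> : \sum_(k < n) (A *m (v - s *: w)) k 0 * w k 0 =
    bform A w v - s * bform A w w.
  by rewrite -bformZr -bformBr bformE; apply: eq_bigr => k _; rewrite mulrC.
rewrite -[X in _ = _ - X]opprB opprK addrC; congr (_ + _).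
rewrite /GRing.scale/= mulr_sumr -sumrN; apply: eq_bigr => k _.
by rewrite !mxE; ring.
Qed.

Lemma energy_descent lambda u : residual lambda u != 0 ->
  \forall v \near u & e \near 0^'+,
    energy A f lambda (v - e *: residual lambda v) < energy A f lambda v.
Proof.
move=> gu0.
(* [- slope (s, v)] is the derivative at [s] of the energy along the step from [v]. Being jointly
   continuous and equal to [sqnorm (residual lambda u) > 0] at [(0, u)], [slope] stays positive
   nearby; the mean value theorem on [[0, e]] then gives the decrease. *)
pose slope (sv : R * 'cV[R]_n) := \sum_(k < n)
  residual lambda (sv.2 - sv.1 *: residual lambda sv.2) k 0 *
  residual lambda sv.2 k 0.
have slope_cont : continuous slope.
  apply: continuous_sum => k; apply: continuous_mul => sv.
    apply: (@continuous_comp _ _ _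
      (fun sv : R * 'cV[R]_n => sv.2 - sv.1 *: residual lambda sv.2)
      (fun v => residual lambda v k 0)).
      apply: cvgB; first exact: cvg_snd.
      apply: cvgZ; first exact: cvg_fst.
      apply: (@continuous_comp _ _ _ snd (residual lambda)); first exact: cvg_snd.
      exact: continuous_residual.
    exact: continuous_residual_coord.
  apply: (@continuous_comp _ _ _ snd (fun v => residual lambda v k 0)).
    exact: cvg_snd.
  exact: continuous_residual_coord.
have : \forall sv \near (0 : R, u), 0 < slope sv.
  have slope0 : slope @ (0 : R, u) --> slope (0, u) by exact: slope_cont.
  apply: (@cvgr_gt R (R * 'cV[R]_n) (nbhs (0 : R, u)) _ slope _ slope0 0).
  rewrite /slope/= scale0r subr0.
  rewrite -sqnorm_gt0 in gu0; apply: lt_le_trans gu0 _.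
  by rewrite le_eqVlt; apply/orP; left; apply/eqP/eq_bigr => k _; rewrite expr2.
move=> -[[/= S U] [/nbhs_ballP[d /= d0 Sd] Uu] SU].
exists (U, [set e | 0 < e < d]) => /=.
  split => //; near=> e; apply/andP; split; near: e; first exact: nbhs_right_gt.
  exact: nbhs_right_lt.
move=> [v e] /= [Uv /andP[e0 ed]].
set w := residual lambda v.
have [|s] := @MVT R (fun t => energy A f lambda (v - t *: w)) _ 0 e e0
  (fun s _ => is_derive_energy lambda v w s).
  apply: continuous_subspaceT => t; apply: differentiable_continuous.
  by apply/derivable1_diffP; have [] := is_derive_energy lambda v w t.
rewrite in_itv/= => /andP[s0 se]; rewrite scale0r !subr0 => Je.
rewrite -subr_lt0 Je mulNr oppr_lt0 mulr_gt0//.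
suff : (S `*` U) (s, v) by move=> /SU.
split => //=; apply: Sd.
by rewrite /ball/= sub0r normrN gtr0_norm// (lt_trans se).
Unshelve. all: by end_near. Qed.

Lemma minimizer_solution lambda u :
  is_global_min (energy A f lambda) u -> is_solution A f lambda u.
Proof.
move=> umin; apply/is_solutionE.
by apply: minimizer_critical umin => v; exact: energy_descent.
Qed.

End energy.

(** * Power functions and the behaviour of the nonlinearity at zero *)

Section growth.
Context {R : realType}.

Lemma powRVK (a D : R) : 0 < a -> 0 <= D -> (D `^ a^-1) `^ a = D.
Proof. by move=> a0 D0; rewrite -powRrM mulVf ?lt0r_neq0// powRr1. Qed.

Lemma powRKV (a D : R) : 0 < a -> 0 <= D -> (D `^ a) `^ a^-1 = D.
Proof. by move=> a0 D0; rewrite -powRrM mulfV ?lt0r_neq0// powRr1. Qed.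

(** Near zero [|f s| <= |s|^nu], and [|s|^(nu - 1)] is eventually below [e]. The limit is punctured,
    so [f 0 = 0] has to come from continuity. *)
Lemma sublinear_near0 (f : R -> R) (nu e : R) : continuous f -> 1 < nu ->
  f s / (`|s| `^ nu) @[s --> 0^'] --> 0 -> 0 < e ->
  \forall s \near 0, `|f s| <= e * `|s|.
Proof.
move=> cf nu1 f0 e0.
have near_f d : 0 < d -> \forall s \near (0 : R)^', `|f s| <= d * `|s|.
  move=> d0; move/cvgr0Pnorm_le : f0 => /(_ _ ltr01) f0.
  have nu10 : 0 < nu - 1 by rewrite subr_gt0.
  have : \forall s \near (0 : R)^', `|s| <= d `^ (nu - 1)^-1.
    rewrite /dnbhs near_withinE; apply/nbhs_ballP.
    exists (d `^ (nu - 1)^-1) => /=; first exact: powR_gt0.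
    by move=> s; rewrite /ball/= sub0r normrN => /ltW.
  have s_neq0 : \forall s \near (0 : R)^', s != 0 by exact: nbhs_dnbhs_neq.
  move: s_neq0 f0; apply: filterS3 => s s0.
  rewrite normrM normfV (ger0_norm (powR_ge0 _ _)) => fs sd.
  have sn0 : 0 < `|s| by rewrite normr_gt0.
  move: fs; rewrite ler_pdivrMr ?powR_gt0// mul1r => /le_trans; apply.
  rewrite -[nu](subrK 1) powRD ?(gt_eqF sn0) ?implybT//.
  rewrite powRr1// ler_wpM2r//.
  rewrite -[leRHS](powRVK nu10 (ltW d0)).
  by apply: ge0_ler_powR; rewrite ?nnegrE ?powR_ge0// ltW.
have f00 : f 0 = 0.
  apply/eqP/contraT => f00.
  have hf0 : 0 < `|f 0| / 2 by rewrite divr_gt0// normr_gt0.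
  have : \forall s \near 0, `|f 0 - f s| < `|f 0| / 2.
    by have /cvgrPdist_lt := cf 0; apply.
  have : \forall s \near (0 : R), `|s| < `|f 0| / 2.
    apply/nbhs_ballP; exists (`|f 0| / 2) => // s.
    by rewrite /ball/= sub0r normrN.
  have := near_f _ ltr01; rewrite /dnbhs near_withinE => h1 h2 h3.
  (* For small [s != 0], [|f 0| <= |f 0 - f s| + |f s|] would be less than [|f 0|]; hence [0] would
     be isolated, which [d / 2] refutes. *)
  have : \forall s \near (0 : R), s = 0.
    near=> s; apply/eqP/contraT => s0.
    have fs1 : `|f s| <= 1 * `|s| by exact: (near h1).
    have fs2 : `|f 0 - f s| < `|f 0| / 2 by exact: (near h3).
    have s1 : `|s| < `|f 0| / 2 by exact: (near h2).
    have := ler_normD (f 0 - f s) (f s); rewrite subrK => h.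
    rewrite mul1r in fs1; exfalso; lra.
  move=> /nbhs_ballP[d /= d0 /(_ (d / 2))].
  rewrite /ball/= sub0r normrN gtr0_norm ?divr_gt0// ltr_pdivrMr//.
  rewrite ltr_pMr// ltr1n => /(_ isT) d20.
  by have := divr_gt0 d0 (ltr0Sn R 1); rewrite d20 ltxx.
have := near_f _ e0; rewrite /dnbhs near_withinE.
by apply: filterS => s; have [->|s0 ->] := eqVneq s 0; rewrite ?f00 ?normr0 ?mulr0.
Unshelve. all: by end_near. Qed.

End growth.

(** * Growth of the potential near zero and at infinity *)

Section potential_bounds.
Context {R : realType} {n : nat}.
Variable f : 'I_n -> R -> R.
Hypothesis f_cont : forall k, continuous (f k).
Implicit Types (u : 'cV[R]_n) (e t : R).

Lemma sum_primitiveE t : sum_primitive f t = potential f (const_mx t).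
Proof. by apply: eq_bigr => k _; rewrite mxE. Qed.

Lemma sum_primitive0 : sum_primitive f 0 = 0.
Proof. by apply: big1 => k _; exact: primitive0. Qed.

Lemma continuous_sum_primitive : continuous (sum_primitive f).
Proof.
apply: continuous_sum => k.
exact: is_derive_continuous (is_derive_primitive (@f_cont k)).
Qed.

Lemma potential_le_near0 e :
  (exists nu0 : R, 1 < nu0 /\
     forall k, f k s / (`|s| `^ nu0) @[s --> 0^'] --> 0) -> 0 < e ->
  exists2 d, 0 < d &
    forall u, (forall k, `|u k 0| < d) -> `|potential f u| <= e * sqnorm u.
Proof.
move=> [nu [nu1 f0]] e0.
have : \forall t \near (0 : R), forall k, `|primitive (f k) t| <= e * t ^+ 2.
  have Fk k : \forall t \near (0 : R), `|primitive (f k) t| <= e * t ^+ 2.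
    have := primitive_le_near0 (primitive0 (f k))
      (is_derive_primitive (@f_cont k)).
    by apply; exact: sublinear_near0 (@f_cont k) nu1 (f0 k) e0.
  exact: filter_forall Fk.
move=> /nbhs_ballP[d /= d0 fd]; exists d => // u ud.
rewrite /potential (le_trans (ler_norm_sum _ _ _))// mulr_sumr ler_sum// => k _.
by apply: fd; rewrite /ball/= sub0r normrN.
Qed.

Lemma potential_le_quadratic e :
  (forall k, f k s / s @[s --> +oo] --> 0 /\ f k s / s @[s --> -oo] --> 0) ->
  0 < e ->
  exists2 C, 0 <= C & forall u, `|potential f u| <= e * sqnorm u + C.
Proof.
move=> fy e0.
have /choice[C HC] k : exists C, 0 <= C /\
    forall t, `|primitive (f k) t| <= e * t ^+ 2 + C.
  have [fpy fNy] := fy k.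
  have [C C0 FC] := primitive_le_quadratic (primitive0 (f k))
    (is_derive_primitive (@f_cont k)) (@f_cont k) e0 fpy fNy.
  by exists C.
exists (\sum_k C k); first by apply: sumr_ge0 => k _; have [] := HC k.
move=> u; rewrite /potential (le_trans (ler_norm_sum _ _ _))// mulr_sumr.
by rewrite -big_split/= ler_sum// => k _; have [_] := HC k; apply.
Qed.

End potential_bounds.

(** * The threshold [lambda_star] and the two solutions *)

Section existence.
Context {R : realType} {n : nat}.
Variables (A : 'M[R]_n) (f : 'I_n -> R -> R).
Hypothesis n_gt0 : (0 < n)%N.
Hypothesis A_sym : A^T = A.
Hypothesis A_posdef : posdef_mx A.
Hypothesis f_cont : forall k, continuous (f k).
Hypothesis f_infty : forall k, f k s / s @[s --> +oo] --> 0 /\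
                               f k s / s @[s --> -oo] --> 0.
Hypothesis f_zero : exists nu0 : R, 1 < nu0 /\
  forall k, f k s / (`|s| `^ nu0) @[s --> 0^'] --> 0.
Implicit Types (u v w : 'cV[R]_n) (lambda t : R).

Let nR_gt0 : 0 < n%:R :> R. Proof. by rewrite ltr0n. Qed.

(** The quotient is at most its value at [t0] both near zero and far away, so its maximum over a
    compact annulus is global. *)
Lemma quotients_maximum t0 : 0 < sum_primitive f t0 ->
  exists2 m, 0 < m & is_maximum (quotients f) m.
Proof.
move=> S0; pose S := sum_primitive f; pose Q t := S t / t ^+ 2.
have t0_neq0 : t0 != 0.
  by apply: contraTneq S0 => ->; rewrite sum_primitive0 ltxx.
have sqr_gt0 t : t != 0 -> 0 < t ^+ 2 by move=> ?; rewrite exprn_even_gt0.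
have Q0 : 0 < Q t0 by rewrite divr_gt0// sqr_gt0.
have [d d0 Sd] : exists2 d, 0 < d & forall t, `|t| < d -> t != 0 -> Q t <= Q t0.
  have e0 : 0 < Q t0 / n%:R by rewrite divr_gt0.
  have [d d0 Hd] := potential_le_near0 f_cont f_zero e0; exists d => // t td tn0.
  rewrite ler_pdivrMr ?sqr_gt0// (le_trans (ler_norm _))//.
  rewrite /S sum_primitiveE (le_trans (Hd _ _))//.
    by move=> k; rewrite mxE.
  by rewrite sqnorm_const mulrA divfK// gt_eqF.
have [M M0 SM] : exists2 M, 0 < M & forall t, M < `|t| -> Q t <= Q t0.
  (* Half of [Q t0] goes to the quadratic term ([n] cancels against [sqnorm (const_mx t)]), the
     other half absorbs [C] once [t ^+ 2 >= 2 * C / Q t0]. The summand [1] in the radius below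
     ensures [|t| <= t ^+ 2]. *)
  have e0 : 0 < Q t0 / 2 / n%:R by rewrite divr_gt0// divr_gt0.
  have [C C0 HC] := potential_le_quadratic f_cont f_infty e0.
  have C2 : 0 <= 2 * C / Q t0.
    by apply: divr_ge0; [exact: mulr_ge0|exact: ltW].
  exists (1 + 2 * C / Q t0); first by rewrite (lt_le_trans ltr01)// lerDl.
  move=> t Mt.
  have t1 : 1 < `|t| by apply: le_lt_trans Mt; rewrite lerDl.
  have tn0 : t != 0 by rewrite -normr_gt0 (lt_trans _ t1).
  rewrite ler_pdivrMr ?sqr_gt0// (le_trans (ler_norm _))//.
  rewrite /S sum_primitiveE (le_trans (HC _))//.
  rewrite sqnorm_const mulrA divfK ?gt_eqF//.
  have Ct : 2 * C / Q t0 <= t ^+ 2.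
    rewrite -real_normK ?num_real// (@le_trans _ _ `|t|)//.
      by rewrite (le_trans _ (ltW Mt))// lerDr.
    by rewrite expr2 ler_peMl// ltW.
  rewrite ler_pdivrMr// in Ct; lra.
(* Comparing with [|t0|] makes the annulus contain [t0]. *)
pose d' := Num.min d `|t0|; pose M' := Num.max M `|t0|.
have d'0 : 0 < d' by rewrite lt_min d0 normr_gt0.
pose K := [set t | d' <= `|t|] `&` `[- M', M']%classic.
have Kt0 : K t0.
  split => /=; first by rewrite ge_min lexx orbT.
  by rewrite in_itv/= -ler_norml le_max lexx orbT.
have Kc : compact K.
  apply: (@subclosed_compact _ _ `[- M', M']%classic).
  - apply: closedI; last exact: interval_closed.
    apply: (@preimage_closed _ _ (fun t : R => `|t|) [set x | d' <= x]).
      by move=> t _; exact: norm_continuous.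
    exact: closed_ge.
  - exact: segment_compact.
  - by move=> t [].
have Qc : {within K, continuous Q}.
  apply: continuous_in_subspaceT => t; rewrite inE => -[/= dt _].
  apply: cvgM; first exact: continuous_sum_primitive.
  apply: cvgV; last exact: exprn_continuous.
  by rewrite gt_eqF// sqr_gt0// -normr_gt0 (lt_le_trans d'0).
have [c] := compact_EVT_max (ex_intro _ t0 Kt0) Kc Qc.
rewrite inE => Kcc cmax.
have Q0c : Q t0 <= Q c by apply: cmax; rewrite inE.
exists (Q c); first exact: lt_le_trans Q0c.
split.
  by exists c => //=; rewrite -normr_gt0 (lt_le_trans d'0)//; case: Kcc.
move=> _ [t /= tn0 <-]; have [td|dt] := ltP `|t| d'.
  apply: le_trans Q0c; apply: Sd => //.
  by rewrite (lt_le_trans td)// ge_min lexx.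
have [Mt|tM] := ltP M' `|t|.
  by apply: le_trans Q0c; apply: SM; rewrite (le_lt_trans _ Mt)// le_max lexx.
by apply: cmax; rewrite inE; split => //=; rewrite in_itv/= -ler_norml.
Qed.

Lemma maximumP (S : set R) :
  (exists m, is_maximum S m) -> is_maximum S (maximum S).
Proof. by move=> Sm; rewrite /maximum; exact: getPex. Qed.

(** By symmetry the entries below the diagonal have the same sum as those above, so the numerator of
    [lambda_star] is the sum of all entries of [A]. *)
Lemma bform_const1 :
  \tr A + 2 * \sum_(i < n) \sum_(j < n | (i < j)%N) A i j =
  bform A (const_mx 1) (const_mx 1).
Proof.
rewrite bformE.
have -> : \sum_(k < n) (const_mx 1 : 'cV[R]_n) k 0 *
      (A *m (const_mx 1 : 'cV[R]_n)) k 0 =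
    \sum_(i < n) \sum_(j < n) A i j.
  apply: eq_bigr => i _; rewrite mxE mul1r mxE.
  by apply: eq_bigr => j _; rewrite mxE mulr1.
have low : \sum_(i < n) \sum_(j < n | (j < i)%N) A i j =
    \sum_(i < n) \sum_(j < n | (i < j)%N) A i j.
  rewrite (exchange_big_dep xpredT)//=; apply: eq_bigr => i _.
  by apply: eq_bigr => j _; rewrite -[in LHS]A_sym mxE.
have row_split (i : 'I_n) : \sum_(j < n) A i j = A i i +
    (\sum_(j < n | (j < i)%N) A i j + \sum_(j < n | (i < j)%N) A i j).
  rewrite (bigID (fun j : 'I_n => (j < i)%N))/= addrCA; congr (_ + _).
  rewrite (bigD1 i) ?ltnn//=; congr (_ + _); apply: eq_bigl => j.
  by rewrite -leqNgt andbC ltn_neqAle eq_sym.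
under [RHS]eq_bigr do rewrite row_split.
by rewrite !big_split/= low /mxtrace; ring.
Qed.

Lemma const1_neq0 : const_mx 1 != 0 :> 'cV[R]_n.
Proof. by rewrite -sqnorm_gt0 sqnorm_const expr1n mulr1. Qed.

Lemma energy_const lambda t : energy A f lambda (const_mx t) =
  t ^+ 2 * (bform A (const_mx 1) (const_mx 1) / 2) - lambda * sum_primitive f t.
Proof.
rewrite energyE sum_primitiveE.
have -> : const_mx t = t *: const_mx 1 :> 'cV[R]_n.
  by apply/colP => i; rewrite !mxE mulr1.
by rewrite bformZr (bformC (t *: _) _ A_sym) bformZr; field.
Qed.

(** Each [f k] vanishes at [0], which makes the origin an admissible endpoint of the mountain
    pass. *)
Lemma residual0 lambda : residual A f lambda 0 = 0.
Proof.
apply/colP => k; rewrite residualE mulmx0 !mxE sub0r.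
have [nu [nu1 f0]] := f_zero.
have /nbhs_singleton := sublinear_near0 (@f_cont k) nu1 (f0 k) ltr01.
by rewrite normr0 mulr0 normr_le0 => /eqP ->; rewrite mulr0 oppr0.
Qed.

Lemma two_solutions lambda w : 0 < lambda -> energy A f lambda w < 0 ->
  exists u1 u2 : 'cV[R]_n,
    [/\ u1 != u2,
        u1 != 0 /\ is_solution A f lambda u1,
        u2 != 0 /\ is_solution A f lambda u2 &
        is_global_min (energy A f lambda) u1].
Proof.
move=> l0 Jw; set J := energy A f lambda.
have [m m0 Am] := posdef_coercive A_posdef.
(* With this [e] the potential costs [m / 4] of the [m / 2] supplied by the quadratic form. *)
pose e := m / (4 * lambda).
have e0 : 0 < e by rewrite divr_gt0// mulr_gt0.
have le : lambda * e = m / 4 by rewrite /e; field; rewrite gt_eqF.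
(* Used twice: with the global constant [C] it gives coercivity, with [C = 0] positivity near the
   origin. *)
have J_ge u C : `|potential f u| <= e * sqnorm u + C ->
    m / 4 * sqnorm u - lambda * C <= J u.
  move=> /(le_trans (ler_norm _)) Pu; rewrite /J energyE.
  have := ler_wpM2l (ltW l0) Pu; rewrite mulrDr mulrA le => lPu.
  have := Am u; lra.
have [C C0 HC] := potential_le_quadratic f_cont f_infty e0.
have [d d0 Hd] := potential_le_near0 f_cont f_zero e0.
have J_cont : continuous J by exact: continuous_energy.
have J_compact a : compact [set u | J u <= a].
  apply: (@sqnorm_bounded_compact _ _ _ ((a + lambda * C) / (m / 4))).
    apply: (@preimage_closed _ _ J [set x | x <= a]) => [u _|].
      exact: J_cont.
    exact: closed_le.
  move=> u /= Ja; rewrite ler_pdivlMr ?divr_gt0// mulrC.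
  by have := J_ge _ _ (HC u); lra.
have [u1] := compact_EVT_min (ex_intro _ w (lexx (J w))) (J_compact (J w))
  (continuous_subspaceT J_cont).
rewrite inE => /= Ju1 u1min'.
have u1min : is_global_min J u1.
  move=> v; have [vw|wv] := leP (J v) (J w); first by apply: u1min'; rewrite inE.
  exact: le_trans Ju1 (ltW wv).
have Ju1_lt0 : J u1 < 0 by exact: le_lt_trans Jw.
have J0 : J 0 = 0.
  rewrite /J energyE bform0l /potential big1 => [|k _].
    by rewrite !mulr0 subr0.
  by rewrite mxE primitive0.
(* If [sqnorm u <= r], all coordinates are at most [d / 2 < d] in absolute value, so the bound near
   zero applies. *)
pose r := (d / 2) ^+ 2.
have r0 : 0 < r by rewrite exprn_gt0// divr_gt0.
have J_small u : sqnorm u <= r -> m / 4 * sqnorm u <= J u.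
  move=> ur; have := @J_ge u 0; rewrite mulr0 subr0 addr0; apply; apply: Hd => k.
  apply: (@le_lt_trans _ _ (d / 2)); last by rewrite ltr_pdivrMr// ltr_pMr// ltr1n.
  have d2 : 0 <= d / 2 by rewrite divr_ge0 ?ltW.
  rewrite -(ler_pXn2r (isT : (0 < 2)%N)) ?nnegrE// real_normK ?num_real//.
  exact: le_trans (coord_le_sqnorm u k) ur.
have alpha0 : 0 < m / 4 * r by rewrite mulr_gt0 ?divr_gt0.
have [||K Kc K0 K1|u2 gu2 Ju2] := @mountain_pass_critical_point R _ J
    (residual A f lambda) J_cont (@continuous_residual _ _ A f f_cont lambda)
    J_compact (@energy_descent _ _ A f A_sym f_cont lambda) 0 u1 (m / 4 * r).
- exact: residual0.
- by apply/is_solutionE; exact: minimizer_solution.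
(* The image of [K] under [sqnorm] is an interval containing [0] and [sqnorm u1]. The latter is at
   least [r], since otherwise [J u1 >= 0]; hence [K] meets the sphere [sqnorm u = r]. *)
- have /connected_intervalP itvK : connected (sqnorm @` K).
    apply: connected_continuous_connected => //.
    exact/continuous_subspaceT/sqnorm_continuous.
  have ru1 : r <= sqnorm u1.
    rewrite leNgt; apply/negP => /ltW /J_small; apply/negP; rewrite -ltNge.
    by rewrite (lt_le_trans Ju1_lt0)// mulr_ge0 ?sqnorm_ge0// divr_ge0// ltW.
  have [u Ku ur] : (sqnorm @` K) r.
    apply: (itvK (sqnorm 0) (sqnorm u1)); [by exists 0|by exists u1|].
    by rewrite ru1 andbT sqnorm0 ltW.
  by exists u => //; rewrite -ur; apply: J_small; rewrite ur.
(* The levels [J u1 < 0 = J 0 < J u2] separate the three points. *)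
exists u1, u2; split => //.
- by apply: contraTneq Ju2 => <-; rewrite -ltNge (lt_trans Ju1_lt0).
- split; first by apply: contraTneq Ju1_lt0 => ->; rewrite J0 ltxx.
  exact: minimizer_solution.
- split; last exact/is_solutionE.
  by apply: contraTneq Ju2 => ->; rewrite J0 -ltNge.
Qed.

Lemma bform_const1_gt0 : 0 < bform A (const_mx 1) (const_mx 1).
Proof. exact/A_posdef/const1_neq0. Qed.

End existence.

(** * Norm of the solutions as [lambda] grows *)

Section asymptotics.
Context {R : realType} {n : nat}.
Variables (A : 'M[R]_n) (f : 'I_n -> R -> R).
Hypothesis n_gt0 : (0 < n)%N.
Hypothesis A_sym : A^T = A.
Hypothesis A_posdef : posdef_mx A.
Hypothesis f_cont : forall k, continuous (f k).
Implicit Types (u : 'cV[R]_n) (lambda q c : R).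

Lemma norm2_ge0 u : 0 <= norm2 u.
Proof. exact: sqrtr_ge0. Qed.

Lemma sqr_norm2 u : norm2 u ^+ 2 = sqnorm u.
Proof. by rewrite sqr_sqrtr// sqnorm_ge0. Qed.

Lemma coord_le_norm2 u k : `|u k 0| <= norm2 u.
Proof.
rewrite -(ler_pXn2r (isT : (0 < 2)%N)) ?nnegrE ?norm2_ge0//.
by rewrite real_normK ?num_real// sqr_norm2 coord_le_sqnorm.
Qed.

(** With [N = norm2 u], testing the system against [u] gives
    [m * N^2 <= lambda * n * c * N^(1 + q)]; dividing by [N^(1 + q)] leaves a bound on
    [N^(1 - q)]. *)
Lemma solution_norm_le (m q c lambda : R) u : 0 < m ->
  (forall v, m * sqnorm v <= bform A v v) -> q < 1 -> 0 <= q -> 0 <= c ->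
  (forall k s, `|f k s| <= c * `|s| `^ q) -> 0 < lambda -> u != 0 ->
  is_solution A f lambda u -> norm2 u <= (lambda * (c * n%:R / m)) `^ (1 - q)^-1.
Proof.
move=> m0 Am q1 q0 c0 fc l0 u0 solu; set N := norm2 u.
have N0 : 0 < N by rewrite sqrtr_gt0 [X in 0 < X]/(sqnorm u) sqnorm_gt0.
have q10 : 0 < 1 - q by rewrite subr_gt0.
have NqE : N `^ (1 - q) * N `^ q = N.
  by rewrite -powRD ?subrK ?powRr1 ?(ltW N0)// (gt_eqF N0) implybT.
have Nq0 : 0 < N `^ q by exact: powR_gt0.
have term_le k : u k 0 * f k (u k 0) <= N * (c * N `^ q).
  rewrite (le_trans (ler_norm _))// normrM ler_pM ?coord_le_norm2//.
  rewrite (le_trans (fc _ _))// ler_wpM2l//.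
  by apply: ge0_ler_powR; rewrite ?nnegrE ?coord_le_norm2// ltW.
have : m * N ^+ 2 <= lambda * (n%:R * (N * (c * N `^ q))).
  rewrite sqr_norm2 (le_trans (Am u))// bformE solu.
  have -> : \sum_(k < n) u k 0 * (lambda *: nonlinearity f u) k 0 =
      lambda * \sum_(k < n) u k 0 * f k (u k 0).
    rewrite mulr_sumr; apply: eq_bigr => k _; rewrite !mxE; ring.
  rewrite ler_wpM2l ?(ltW l0)// (le_trans (ler_sum _ (fun k _ => term_le k)))//.
  by rewrite sumr_const card_ord mulr_natl.
have -> : lambda * (n%:R * (N * (c * N `^ q))) =
    m * (lambda * (c * n%:R / m)) * N * N `^ q by field; rewrite gt_eqF.
have -> : m * N ^+ 2 = m * N `^ (1 - q) * N * N `^ q.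
  by rewrite expr2 -{1}NqE; ring.
rewrite !ler_pM2r// ler_pM2l// => NqD.
rewrite -[leLHS](powRKV q10 (ltW N0)).
apply: ge0_ler_powR => //; rewrite ?nnegrE ?invr_ge0 ?powR_ge0 ?(ltW q10)//.
exact: le_trans (powR_ge0 _ _) NqD.
Qed.

Lemma solutions_littleo q c r (l0 : R) (u1 : R -> 'cV[R]_n) :
  0 <= q -> q < r < 1 -> 0 <= c ->
  (forall k s, `|f k s| <= c * `|s| `^ q) ->
  (forall lambda, l0 < lambda ->
     u1 lambda != 0 /\ is_solution A f lambda (u1 lambda)) ->
  (fun lambda : R => norm2 (u1 lambda)) =o_+oo
    (fun lambda : R => lambda `^ (1 / (1 - r))).
Proof.
move=> q0 /andP[qr r1] c0 fc u1sol.
have [m m0 Am] := posdef_coercive A_posdef.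
apply/eqoP => eps eps0.
pose p := (1 - q)^-1; pose p' := 1 / (1 - r).
have r10 : 0 < 1 - r by rewrite subr_gt0.
have q10 : 0 < 1 - q by rewrite subr_gt0 (lt_trans qr).
have pp' : 0 < p' - p.
  by rewrite subr_gt0 /p' /p div1r ltf_pV2 ?posrE// ltrD2l ltrN2.
set D := c * n%:R / m.
have D0 : 0 <= D by rewrite divr_ge0 ?mulr_ge0// ltW.
have De0 : 0 <= D `^ p / eps by rewrite divr_ge0 ?powR_ge0// ltW.
near=> lambda.
have ll0 : l0 < lambda by near: lambda; apply: nbhs_pinfty_gt; exact: num_real.
have lam0 : 0 < lambda by near: lambda; apply: nbhs_pinfty_gt; exact: num_real.
(* Since [p < p'], this threshold ensures [D^p <= eps * lambda^(p' - p)]. *)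
have lamD : (D `^ p / eps) `^ (p' - p)^-1 <= lambda.
  by near: lambda; apply: nbhs_pinfty_ge; exact: num_real.
have [u0 usol] := u1sol _ ll0.
rewrite !ger0_norm ?powR_ge0 ?norm2_ge0//.
rewrite (le_trans
  (solution_norm_le m0 Am (lt_trans qr r1) q0 c0 fc lam0 u0 usol))//.
rewrite -/D -/p -/p' powRM ?(ltW lam0)//.
have -> : lambda `^ p' = lambda `^ p * lambda `^ (p' - p).
  by rewrite -powRD ?subrKC// (gt_eqF lam0) implybT.
rewrite mulrCA ler_wpM2l ?powR_ge0// -ler_pdivrMl// mulrC.
rewrite -[leLHS](powRVK pp' De0); apply: ge0_ler_powR => //.
- exact: ltW.
- by rewrite nnegrE powR_ge0.
- by rewrite nnegrE ltW.
Unshelve. all: by end_near. Qed.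

(** The exponent [1 / (1 - mu)] is negative, so the bound would force the norm to zero. Then the
    potential at [u1 lambda] is at most [b / 2] and the energy at least [- lambda * b / 2], while at
    the constant vector [t0] it is [a - lambda * b]. *)
Lemma minimizers_not_bigO t0 mu (l0 : R) (u1 : R -> 'cV[R]_n) :
  (exists nu0 : R, 1 < nu0 /\
     forall k, f k s / (`|s| `^ nu0) @[s --> 0^'] --> 0) ->
  0 < sum_primitive f t0 -> 1 < mu ->
  (forall lambda, l0 < lambda -> is_global_min (energy A f lambda) (u1 lambda)) ->
  ~ ((fun lambda : R => norm2 (u1 lambda)) =O_+oo
       (fun lambda : R => lambda `^ (1 / (1 - mu)))).
Proof.
move=> f_zero S0 mu1 u1min /eqOP/bigO_exP[k /= k0 u1k].
have [d d0 Hd] := potential_le_near0 f_cont f_zero ltr01.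
set b := sum_primitive f t0 in S0.
pose a := t0 ^+ 2 * (bform A (const_mx 1) (const_mx 1) / 2).
pose s := (mu - 1)^-1; have s0 : 0 < s by rewrite invr_gt0 subr_gt0.
(* Norm below [d] bounds the potential by the squared norm; norm below the root makes the latter at
   most [b / 2]. *)
pose e := Num.min d (Num.sqrt (b / 2)).
have b20 : 0 < b / 2 by rewrite divr_gt0.
have e0 : 0 < e by rewrite lt_min d0 sqrtr_gt0.
have ke0 : 0 <= k / e by rewrite divr_ge0 ?ltW.
have : \forall lambda \near pinfty_nbhs R, False.
  near=> lambda.
  have ll0 : l0 < lambda by near: lambda; apply: nbhs_pinfty_gt; exact: num_real.
  have lam0 : 0 < lambda by near: lambda; apply: nbhs_pinfty_gt; exact: num_real.
  have lama : 2 * a / b < lambda.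
    by near: lambda; apply: nbhs_pinfty_gt; exact: num_real.
  (* This gives [k * lambda^(- s) < e]; the added [1] makes the inequality strict. *)
  have lamk : (k / e + 1) `^ s^-1 <= lambda.
    by near: lambda; apply: nbhs_pinfty_ge; exact: num_real.
  have ks : k / e < lambda `^ s.
    apply: (@lt_le_trans _ _ (k / e + 1)); first by rewrite ltrDl.
    have ke1 : 0 <= k / e + 1 by rewrite addr_ge0.
    rewrite -[leLHS](powRVK s0 ke1); apply: ge0_ler_powR => //.
    - exact: ltW.
    - by rewrite nnegrE powR_ge0.
    - by rewrite nnegrE ltW.
  have : `|norm2 (u1 lambda)| <= k * `|lambda `^ (1 / (1 - mu))|.
    exact: (near u1k).
  rewrite !ger0_norm ?powR_ge0 ?norm2_ge0//.
  have -> : 1 / (1 - mu) = - s by rewrite /s -invrN opprB div1r.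
  rewrite powRN => Nk.
  have Ne : norm2 (u1 lambda) < e.
    apply: le_lt_trans Nk _; rewrite ltr_pdivrMr ?powR_gt0//.
    by rewrite mulrC -ltr_pdivrMr.
  have PN : potential f (u1 lambda) <= b / 2.
    apply: (le_trans (ler_norm _)); apply: (le_trans (Hd _ _)) => [j|].
      rewrite (le_lt_trans (coord_le_norm2 _ _))// (lt_le_trans Ne)//.
      by rewrite ge_min lexx.
    rewrite mul1r -sqr_norm2 -(sqr_sqrtr (ltW b20)).
    rewrite ler_pXn2r ?nnegrE ?norm2_ge0 ?sqrtr_ge0//.
    by rewrite (le_trans (ltW Ne))// ge_min lexx orbT.
  have := u1min _ ll0 (const_mx t0).
  rewrite energy_const// -/a -/b energyE => Jle.
  have B0 : 0 <= bform A (u1 lambda) (u1 lambda).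
    have [m m0 Am] := posdef_coercive A_posdef.
    by rewrite (le_trans _ (Am _))// mulr_ge0 ?sqnorm_ge0 ?ltW.
  have lP : lambda * potential f (u1 lambda) <= lambda * (b / 2).
    by rewrite ler_wpM2l ?(ltW lam0).
  rewrite ltr_pdivrMr// in lama; lra.
by move/filter_ex => [].
Unshelve. all: by end_near. Qed.

End asymptotics.

(** * Existence and asymptotics combined at the threshold [lambda_star] *)

Unset Implicit Arguments.

Theorem theorem3p1 (R : realType) (n : nat) (hn : (1 <= n)%N)
  (A : 'M[R]_n) (A_sym : A^T = A) (A_posdef : posdef_mx A)
  (f : 'I_n -> R -> R) (f_cont : forall k, continuous (f k))
  (f_infty : forall k, f k s / s @[s --> +oo] --> 0 /\
                       f k s / s @[s --> -oo] --> 0)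
  (f_zero : exists nu0 : R, 1 < nu0 /\
     forall k, f k s / (`|s| `^ nu0) @[s --> 0^'] --> 0)
  (sup_pos : (0 < ereal_sup (range (fun t : R => (sum_primitive f t)%:E)))%E) :
  (exists m, is_maximum (quotients f) m) /\
  0 < lambda_star A f /\
  (forall lambda : R, lambda_star A f < lambda ->
     exists u1 u2 : 'cV[R]_n,
       [/\ u1 != u2,
           u1 != 0 /\ is_solution A f lambda u1,
           u2 != 0 /\ is_solution A f lambda u2 &
           is_global_min (energy A f lambda) u1]) /\
  (forall q c : R, 0 < q < 1 -> 0 < c ->
     (forall k s, `|f k s| <= c * `|s| `^ q) ->
     (* [u1] ranges over all possible choices of the first solution above;
        its values for lambda <= lambda_star are irrelevant *)
     forall u1 : R -> 'cV[R]_n,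
       (forall lambda : R, lambda_star A f < lambda ->
          [/\ u1 lambda != 0,
              is_solution A f lambda (u1 lambda) &
              is_global_min (energy A f lambda) (u1 lambda)]) ->
       (forall r : R, q < r < 1 ->
          (fun lambda : R => norm2 (u1 lambda)) =o_+oo
            (fun lambda : R => lambda `^ (1 / (1 - r)))) /\
       (forall mu : R, 1 < mu ->
          ~ ((fun lambda : R => norm2 (u1 lambda)) =O_+oo
               (fun lambda : R => lambda `^ (1 / (1 - mu)))))).
Proof.
have [_ [t0 _ <-] ] := ereal_sup_gt sup_pos; rewrite lte_fin => S0.
have [m m0 mmax] := quotients_maximum hn f_cont f_infty f_zero S0.
have maxE : maximum (quotients f) = m.
  have [[Qm ubm] [Qm' ubm']] := (mmax, maximumP (ex_intro _ m mmax)).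
  by apply/eqP; rewrite eq_le ubm// ubm'.
have B0 := bform_const1_gt0 hn A_posdef.
set B := bform A _ _ in B0.
have lE : lambda_star A f = B / 2 / m by rewrite /lambda_star maxE bform_const1.
have l0 : 0 < lambda_star A f by rewrite lE !divr_gt0.
split; first by exists m.
split => //; split.
  move=> lambda llt; have lam0 := lt_trans l0 llt.
  (* At the point [t] where the maximum [m] is attained, the energy of the constant vector is
     [t ^+ 2 * (B / 2 - lambda * m)], negative exactly above the threshold. *)
  have [[t /= tn0 Qt] _] := mmax.
  apply: (two_solutions A_sym A_posdef f_cont f_infty f_zero lam0
            (w := const_mx t)).
  rewrite energy_const// -/B.
  have t20 : 0 < t ^+ 2 by rewrite exprn_even_gt0.
  have -> : sum_primitive f t = t ^+ 2 * m by rewrite -Qt; field.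
  rewrite [lambda * _]mulrCA -mulrBr pmulr_rlt0// subr_lt0.
  by rewrite -ltr_pdivrMr// -lE.
move=> q c /andP[q0 q1] c0 fc u1 u1P; split.
  move=> r qr.
  apply: (solutions_littleo A_posdef (ltW q0) qr (ltW c0) fc
    (l0 := lambda_star A f)) => lambda /u1P[].
  by split.
move=> mu mu1.
apply: (minimizers_not_bigO A_sym A_posdef f_cont f_zero S0 mu1
  (l0 := lambda_star A f)) => lambda /u1P[].
by [].
Qed.
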